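(* Let $X,Y$ be pointed metric spaces. If $0<p_1\le p_2$; $0<q_1\le q_2$; $0<s_1\le s_2$; $q_j\le s_j$ and $q_j\le p_j$ for $j=1,2$; and $$\frac1{q_1}-\frac1{q_2}\le\frac1{s_1}-\frac1{s_2}\le\frac1{p_1}-\frac1{p_2},$$ then $$\Pi^L_{(p_1,\mathfrak{m}^L(s_1;q_1))}(X,Y)\subset\Pi^L_{(p_2,\mathfrak{m}^L(s_2;q_2))}(X,Y).$$ Moreover $\pi^L_{(p_2,\mathfrak{m}^L(s_2;q_2))}(T)\le\pi^L_{(p_1,\mathfrak{m}^L(s_1;q_1))}(T)$ for every $T\in\Pi^L_{(p_1,\mathfrak{m}^L(s_1;q_1))}(X,Y)$.
   Context: For a metric space $X$ with base point $x_0$, $X^{\#}$ is the Banach space of real-valued Lipschitz functions on $X$ vanishing at $x_0$, with norm $Lip(\cdot)$ (the Lipschitz constant); $B_{X^{\#}}$ is its closed unit ball. $(\sigma,x',x'')$ denotes a finite sequence $(\sigma_j,x'_j,x''_j)_{j=1}^m$ in $\mathbb{R}\times X\times X$. Indices lie in $(0,\infty]$, $1/\infty=0$. Put $\|(\sigma,x',x'')|\ell_p\|=\big[\sum_j|\sigma_j|^p d_X(x'_j,x''_j)^p\big]^{1/p}$ and $\|(\sigma,x',x'')|\ell_p^{L,w}\|=\sup_{f\in B_{X^{\#}}}\big[\sum_j|\sigma_j|^p|f(x'_j)-f(x''_j)|^p\big]^{1/p}$ (sums replaced by suprema over $j$ if $p=\infty$). For $0<q\le s\le\infty$ let $s'(q)\in(0,\infty]$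 be given by $\frac1{s'(q)}+\frac1s=\frac1q$, and put $\mathfrak{m}^L_{(s;q)}(\sigma,x',x'')=\inf_\tau\|\tau|\ell_{s'(q)}\|\,\|(\sigma/\tau,x',x'')|\ell_s^{L,w}\|$, the infimum over all $\tau=(\tau_j)$ with $\tau_j\in\mathbb{R}\setminus\{0\}$, where $\sigma/\tau=(\sigma_j/\tau_j)_j$. For $q\le s$ and $p\ge q$, a Lipschitz map $T:X\to Y$ is Lipschitz $(p,\mathfrak{m}^L(s;q))$-summing if there is $C\ge0$ with $\|(\sigma,Tx',Tx'')|\ell_p\|\le C\,\mathfrak{m}^L_{(s;q)}(\sigma,x',x'')$ for all finite sequences $(\sigma,x',x'')$ in $\mathbb{R}\times X\times X$; $\Pi^L_{(p,\mathfrak{m}^L(s;q))}(X,Y)$ is the class of all such maps and $\pi^L_{(p,\mathfrak{m}^L(s;q))}(T)$ is the infimum of such $C$. *)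

(* Defs.v *)
From HB Require Import structures.
From mathcomp Require Import all_boot all_order all_algebra.
From mathcomp Require Import all_classical all_reals all_analysis.

Set Implicit Arguments.
Unset Strict Implicit.
Unset Printing Implicit Defensive.

Import Order.TTheory GRing.Theory Num.Theory.
Import numFieldNormedType.Exports.

Local Open Scope classical_set_scope.
Local Open Scope ring_scope.

(* Indices in (0, +oo] are extended reals p with 0 < p; in ereal_scope the
   library inverse satisfies +oo^-1 = 0 and 0^-1 = +oo. *)

(* The value at -oo is junk (indices are positive). *)
Definition lnorm (R : realType) (p : \bar R) (m : nat) (a : 'I_m -> R) : R :=
  match p with
  | r%:E => (\sum_(j < m) `|a j| `^ r) `^ r^-1
  | +oo%E => \big[Num.max/0]_(j < m) `|a j|
  | -oo%E => 0
  end.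

Definition lip_bound (R : realType) (X Y : metricType R) (f : X -> Y) : set R :=
  [set C | 0 <= C /\ forall x y, mdist (f x) (f y) <= C * mdist x y].

Definition is_lipschitz (R : realType) (X Y : metricType R) (f : X -> Y) : Prop :=
  lip_bound f !=set0.

(* Only meaningful when is_lipschitz f holds. *)
Definition lip_const (R : realType) (X Y : metricType R) (f : X -> Y) : R :=
  inf (lip_bound f).

(* R is a metricType, with mdist x y = `|y - x|, under its alias R^o. *)
Definition lip_dual (R : realType) (X : metricType R) (x0 : X) : set (X -> R) :=
  [set f : X -> R | is_lipschitz (f : X -> R^o) /\ f x0 = 0].

Definition lip_dual_ball (R : realType) (X : metricType R) (x0 : X) :
    set (X -> R) :=
  [set f : X -> R | lip_dual x0 f /\ lip_const (f : X -> R^o) <= 1].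

Definition strong_lnorm (R : realType) (X : metricType R) (p : \bar R)
    (m : nat) (sigma : 'I_m -> R) (x' x'' : 'I_m -> X) : R :=
  lnorm p (fun j => sigma j * mdist (x' j) (x'' j)).

Definition weak_lip_lnorm (R : realType) (X : metricType R) (x0 : X)
    (p : \bar R) (m : nat) (sigma : 'I_m -> R) (x' x'' : 'I_m -> X) : \bar R :=
  ereal_sup [set (lnorm p (fun j => sigma j * (f (x' j) - f (x'' j))))%:E
            | f in lip_dual_ball x0].

(* The index s'(q); see conj_index_gt0 and conj_indexE. *)
Definition conj_index (R : realType) (s q : \bar R) : \bar R :=
  ((q^-1 - s^-1)^-1)%E.

Definition mixed_lip_norm (R : realType) (X : metricType R) (x0 : X)
    (s q : \bar R) (m : nat) (sigma : 'I_m -> R) (x' x'' : 'I_m -> X) : \bar R :=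
  ereal_inf [set ((lnorm (conj_index s q) tau)%:E *
                  weak_lip_lnorm x0 s (fun j => (sigma j / tau j)%R) x' x'')%E
            | tau in [set tau : 'I_m -> R | forall j, tau j != 0]].

Definition summing_bound (R : realType) (X Y : metricType R) (x0 : X)
    (p s q : \bar R) (T : X -> Y) : set R :=
  [set C | 0 <= C /\
    forall (m : nat) (sigma : 'I_m -> R) (x' x'' : 'I_m -> X),
      ((strong_lnorm p sigma (T \o x') (T \o x''))%:E <=
        C%:E * mixed_lip_norm x0 s q sigma x' x'')%E].

Definition lip_mixed_summing (R : realType) (X Y : metricType R) (x0 : X)
    (p s q : \bar R) : set (X -> Y) :=
  [set T | is_lipschitz T /\ summing_bound x0 p s q T !=set0].

(* Equal to +oo when no constant is admissible. *)
Definition lip_mixed_summing_norm (R : realType) (X Y : metricType R) (x0 : X)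
    (p s q : \bar R) (T : X -> Y) : \bar R :=
  ereal_inf [set C%:E | C in summing_bound x0 p s q T].

Section conj_index_theory.
Local Open Scope ereal_scope.
Context {R : realType}.
Implicit Types q s : \bar R.

Let inve_fin s : 0 < s -> s^-1 \is a fin_num.
Proof.
by case: s => [r||]//; rewrite lte_fin inver => r0; rewrite gt_eqF.
Qed.

Lemma conj_index_gt0 q s : 0 < q -> q <= s -> 0 < conj_index s q.
Proof.
move=> q0 qs; have s0 := lt_le_trans q0 qs.
have qsV : s^-1 <= q^-1 by rewrite lee_pV2// inE ltW.
rewrite lt_neqAle inve_ge0 sube_ge0 ?inve_fin// qsV andbT.
rewrite eq_sym inve_eq0; apply/eqP => dy.
have: q^-1 - s^-1 \is a fin_num by rewrite fin_numB !inve_fin.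
by rewrite dy.
Qed.

Lemma conj_indexE q s : 0 < q -> q <= s -> (conj_index s q)^-1 + s^-1 = q^-1.
Proof.
by move=> q0 qs; rewrite inveK subeK// inve_fin// (lt_le_trans q0 qs).
Qed.

End conj_index_theory.

(* Main.v *)
Require Import Defs.
From HB Require Import structures.
From mathcomp Require Import all_boot all_order all_algebra.
From mathcomp Require Import all_classical all_reals all_analysis.
From mathcomp Require Import ring lra.

Set Implicit Arguments.
Unset Strict Implicit.
Unset Printing Implicit Defensive.

Import Order.TTheory GRing.Theory Num.Theory.
Import numFieldNormedType.Exports.

Local Open Scope classical_set_scope.
Local Open Scope ereal_scope.

(** Write 1/r = 1/s1 - 1/s2, with r in (0, +oo]. The hypotheses on the indices
    become 1/r + 1/p2 <= 1/p1 and s2'(q2) <= s1'(q1). Let C be an admissible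
    constant of T for (p1, s1, q1), and let (sigma, x', x'') and tau be given;
    put a_j = sigma_j d(T x'_j, T x''_j).

    Equality in the Hoelder inequality provides real b_j with r-norm at most
    1 such that the p2-norm of a is at most the p1-norm of b * a
    ([lnorm_extremal_mult]). That last norm is the strong norm of the images
    for the sequence b * sigma, so the hypothesis on T bounds it by C times
    the s1'(q1)-norm of tau times the weak s1-norm of b * sigma / tau. By
    the Hoelder inequality with 1/s1 = 1/r + 1/s2, applied for each function
    of the dual ball ([weak_lip_lnorm_hoelder]), that weak norm is at most
    the weak s2-norm of sigma / tau, and the s1'(q1)-norm of tau is at most
    its s2'(q2)-norm because norms of finite sequences decrease in the index
    ([ler_lnorm_index]). Taking the infimum over tau, C is admissible for
    (p2, s2, q2). So every constant admissible for the first triple is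
    admissible for the second ([summing_bound_incl]), which gives both the
    inclusion of the classes and the inequality of their norms. *)

(** * Reciprocals of positive indices *)

Section index_theory.
Local Open Scope ring_scope.
Context {R : realType}.
Implicit Types p q s t : \bar R.

Lemma lee_gt0V2 p q : (0 < p)%E -> (0 < q)%E -> (p^-1 <= q^-1)%E = (q <= p)%E.
Proof. by move=> p0 q0; apply: lee_pV2; rewrite inE ltW. Qed.

Lemma inve_EFin (x : R) : 0 < x -> (x%:E^-1 = x^-1%:E)%E.
Proof. by move=> x0; rewrite inver gt_eqF. Qed.

Lemma inve_sum_EFin (x y : R) t : 0 < x -> 0 < y -> (0 < t)%E ->
  (x%:E^-1 + y%:E^-1 = t^-1)%E ->
  exists z : R, [/\ 0 < z, t = z%:E & x^-1 + y^-1 = z^-1].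
Proof.
move=> x0 y0; rewrite !inve_EFin// -EFinD; case: t => [z| |//]; last first.
  rewrite invey => _ [] /eqP.
  by rewrite gt_eqF// addr_gt0 ?invr_gt0.
by rewrite lte_fin => z0; rewrite inve_EFin// => -[xyz]; exists z.
Qed.

Lemma inve_fin_num p : (0 < p)%E -> (p^-1)%E \is a fin_num.
Proof. by case: p => [x| |]// x0; rewrite inve_EFin. Qed.

Lemma leeB_inve_swap p q s t : (0 < p -> 0 < q -> 0 < s -> 0 < t ->
  p^-1 - q^-1 <= s^-1 - t^-1 -> p^-1 - s^-1 <= q^-1 - t^-1)%E.
Proof.
move=> /inve_fin_num + /inve_fin_num + /inve_fin_num + /inve_fin_num.
move: (p^-1)%E (q^-1)%E (s^-1)%E (t^-1)%E.
move=> [u| |]// [v| |]// [w| |]// [z| |]// _ _ _ _.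
by rewrite -!EFinB !lee_fin; lra.
Qed.

End index_theory.

(** * Norms of finite real sequences *)

Section lnorm_theory.
Local Open Scope ring_scope.
Context {R : realType}.
Implicit Types (p q r s t : \bar R) (m : nat).

Lemma lnorm_ge0 p m (a : 'I_m -> R) : 0 <= lnorm p a.
Proof. by case: p => [x||] //=; [exact: powR_ge0|exact: bigmax_ge_id]. Qed.

Lemma lnorm_powRE (x : R) m (a : 'I_m -> R) : 0 < x ->
  lnorm x%:E a `^ x = \sum_(j < m) `|a j| `^ x.
Proof.
move=> x0; rewrite /= -powRrM mulVf ?gt_eqF// powRr1//.
by apply: sumr_ge0 => j _; exact: powR_ge0.
Qed.

Lemma lnorm_le_sumE (x : R) m (a : 'I_m -> R) (M : R) : 0 < x -> 0 <= M ->
  (lnorm x%:E a <= M) = (\sum_(j < m) `|a j| `^ x <= M `^ x).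
Proof.
move=> x0 M0; rewrite -lnorm_powRE//.
by rewrite (le_mono_in (gt0_ltr_powR x0)) ?nnegrE ?lnorm_ge0.
Qed.

Lemma lnorm_ge_sumE (x : R) m (a : 'I_m -> R) (M : R) : 0 < x -> 0 <= M ->
  (M <= lnorm x%:E a) = (M `^ x <= \sum_(j < m) `|a j| `^ x).
Proof.
move=> x0 M0; rewrite -lnorm_powRE//.
by rewrite (le_mono_in (gt0_ltr_powR x0)) ?nnegrE ?lnorm_ge0.
Qed.

Lemma lnorm_coord p m (a : 'I_m -> R) j : (0 < p)%E -> `|a j| <= lnorm p a.
Proof.
case: p => [x| |//]; rewrite ?lte_fin => x0; last exact: le_bigmax.
rewrite lnorm_ge_sumE// (bigD1 j)//= lerDl.
by apply: sumr_ge0 => i _; exact: powR_ge0.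
Qed.

Lemma ler_lnorm p m (a b : 'I_m -> R) : (0 < p)%E ->
  (forall j, `|a j| <= `|b j|) -> lnorm p a <= lnorm p b.
Proof.
case: p => [x| |//]; rewrite ?lte_fin => x0 ab; last first.
  by apply: le_bigmax2 => j _; exact: ab.
rewrite lnorm_le_sumE ?lnorm_ge0// lnorm_powRE//; apply: ler_sum => j _.
by apply: ge0_ler_powR; rewrite ?nnegrE ?ab ?(ltW x0).
Qed.

Lemma lnormZ p m (c : R) (a : 'I_m -> R) : (0 < p)%E -> 0 <= c ->
  lnorm p (fun j => c * a j) = c * lnorm p a.
Proof.
case: p => [x| |//]; rewrite ?lte_fin => x0 c0 /=; last first.
  rewrite (big_endo ( *%R c)) ?mulr0//.
    by apply: eq_bigr => j _; rewrite normrM ger0_norm.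
  by move=> u v; rewrite maxr_pMr.
under eq_bigr do rewrite normrM ger0_norm// powRM//.
rewrite -mulr_sumr powRM ?powR_ge0//; last first.
  by apply: sumr_ge0 => j _; exact: powR_ge0.
by rewrite -powRrM divff ?gt_eqF// powRr1.
Qed.

(** Each entry is at most the p-norm M, which settles q = +oo; for finite q,
    |a j|^q is then at most M^(q - p) |a j|^p, and summing over j bounds the
    q-norm by M. *)
Lemma ler_lnorm_index p q m (a : 'I_m -> R) : (0 < p)%E -> (p <= q)%E ->
  lnorm q a <= lnorm p a.
Proof.
move=> p0; case: q => [y| |]; last first.
- by rewrite leeNy_eq => /eqP pE; rewrite pE in p0.
- move=> _ /=; apply: bigmax_le => [|j _]; first exact: lnorm_ge0.
  exact: lnorm_coord.
case: p p0 => [x| |//]; rewrite ?lte_fin ?lee_fin => // x0 xy.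
have y0 := lt_le_trans x0 xy.
rewrite lnorm_le_sumE ?lnorm_ge0//.
set M := lnorm _ _; have M0 : 0 <= M by exact: lnorm_ge0.
have split_exp (z : R) : z `^ y = z `^ (y - x) * z `^ x.
  by rewrite -powRD subrK// gt_eqF.
rewrite (split_exp M) lnorm_powRE// mulr_sumr; apply: ler_sum => j _.
rewrite split_exp; apply: ler_wpM2r; first exact: powR_ge0.
apply: ge0_ler_powR; rewrite ?subr_ge0 ?nnegrE//.
exact: lnorm_coord.
Qed.

Lemma lnorm_eq0 p m (a : 'I_m -> R) : (0 < p)%E -> lnorm p a = 0 ->
  forall j, a j = 0.
Proof.
move=> p0 a0 j; apply/eqP; rewrite -normr_le0 -a0; exact: lnorm_coord.
Qed.

Lemma lnorm_normalize (x : R) m (a : 'I_m -> R) : 0 < x ->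
  lnorm x%:E a != 0 -> \sum_(j < m) (`|a j| / lnorm x%:E a) `^ x = 1.
Proof.
move=> x0 aN0; have N0 : 0 <= (lnorm x%:E a)^-1 by rewrite invr_ge0 lnorm_ge0.
under eq_bigr do rewrite powRM//.
rewrite -mulr_suml -lnorm_powRE// -powRM ?lnorm_ge0//.
by rewrite divff// powR1.
Qed.

(** Hoelder inequality for indices in (0, +oo], including those below 1, where
    the norms are only quasi-norms. For finite indices, normalize both factors
    and sum Young's inequality applied to the t-th powers of the entries, with
    the conjugate exponents r/t and s/t. *)
Lemma lnorm_hoelder r s t m (b a : 'I_m -> R) :
  (0 < r)%E -> (0 < s)%E -> (0 < t)%E -> (r^-1 + s^-1 = t^-1)%E ->
  lnorm t (fun j => b j * a j) <= lnorm r b * lnorm s a.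
Proof.
move=> r0 s0 t0 rst.
(* An infinite index only costs the largest entry. *)
have bounded p (u v : 'I_m -> R) : (0 < p)%E ->
    lnorm p (fun j => u j * v j) <= lnorm +oo%E u * lnorm p v.
  move=> p0; rewrite -lnormZ ?lnorm_ge0//; apply: ler_lnorm => // j.
  rewrite !normrM ler_wpM2r//; apply: le_trans (ler_norm _).
  exact: lnorm_coord.
case: r r0 rst => [x| |//]; last first.
  by rewrite invey add0e => _ /(can_inj inveK) <-; exact: bounded.
case: s s0 => [y| |//]; last first.
  rewrite invey adde0 => _ _ /(can_inj inveK) ->; rewrite mulrC.
  by under [X in lnorm _ X]funext do rewrite mulrC; exact: bounded.
rewrite !lte_fin => y0 x0 /(inve_sum_EFin x0 y0 t0) [z [z0 -> xyz]].
have [b0|bN0] := eqVneq (lnorm x%:E b) 0.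
  rewrite b0 mul0r lnorm_le_sumE// powR0 ?gt_eqF// big1// => j _.
  by rewrite (lnorm_eq0 _ b0)// mul0r normr0 powR0// gt_eqF.
have [a0|aN0] := eqVneq (lnorm y%:E a) 0.
  rewrite a0 mulr0 lnorm_le_sumE// powR0 ?gt_eqF// big1// => j _.
  by rewrite (lnorm_eq0 _ a0)// mulr0 normr0 powR0// gt_eqF.
have := lnorm_normalize x0 bN0; have := lnorm_normalize y0 aN0.
have := lnorm_ge0 x%:E b; have := lnorm_ge0 y%:E a.
move: (lnorm x%:E b) (lnorm y%:E a) bN0 aN0 => B A bN0 aN0 A0 B0 sumA sumB.
rewrite lnorm_le_sumE ?(mulr_ge0 B0 A0)//.
have young j : `|b j * a j| `^ z <=
    (B * A) `^ z * (z / x * (`|b j| / B) `^ x + z / y * (`|a j| / A) `^ y).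
  have -> : `|b j * a j| = B * A * ((`|b j| / B) * (`|a j| / A)).
    by rewrite normrM; field; rewrite bN0 aN0.
  have bB0 : 0 <= `|b j| / B by rewrite divr_ge0.
  have aA0 : 0 <= `|a j| / A by rewrite divr_ge0.
  rewrite (powRM z (mulr_ge0 B0 A0) (mulr_ge0 bB0 aA0)).
  apply: ler_wpM2l; first exact: powR_ge0.
  rewrite (powRM z bB0 aA0).
  have := @conjugate_powR R ((`|b j| / B) `^ z) ((`|a j| / A) `^ z)
    (x / z) (y / z) (powR_ge0 _ _) (powR_ge0 _ _)
    (divr_gt0 x0 z0) (divr_gt0 y0 z0).
  rewrite -!powRrM ![z * (_ / _)]mulrC !divfK ?gt_eqF// !invf_div.
  rewrite -mulrDr xyz divff ?gt_eqF// => /(_ erefl).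
  by rewrite [_ * (z / x)]mulrC [_ * (z / y)]mulrC.
apply: le_trans (ler_sum _ (fun j _ => young j)) _.
rewrite -mulr_sumr big_split/= -!mulr_sumr sumA sumB !mulr1.
by rewrite -mulrDr xyz divff ?gt_eqF// mulr1.
Qed.

(** The Hoelder inequality is sharp: for finite indices, equality is attained
    by a b proportional to a power of |a|. This gives the exponent p with
    1/p = 1/r + 1/q, and smaller p follow by monotonicity of the norms in the
    index. *)
Lemma lnorm_extremal_mult p q r m (a : 'I_m -> R) :
  (0 < p)%E -> (0 < q)%E -> (0 < r)%E -> (r^-1 + q^-1 <= p^-1)%E ->
  exists2 b : 'I_m -> R, lnorm r b <= 1 &
    lnorm q a <= lnorm p (fun j => b j * a j).
Proof.
move=> p0 q0 r0 rqp.
have [aq0|aqN0] := eqVneq (lnorm q a) 0.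
  exists (fun j => 0 * a j); last by rewrite aq0 lnorm_ge0.
  by rewrite lnormZ// mul0r.
case: r r0 rqp => [x| |//]; last first.
  rewrite invey add0e lee_gt0V2// => _ pq; exists (fun=> 1).
    by apply: bigmax_le => // j _; rewrite normr1.
  apply: le_trans (ler_lnorm_index a p0 pq) _.
  by apply: ler_lnorm => // j; rewrite mul1r.
rewrite lte_fin => x0.
case: q q0 aqN0 => [y| |//]; last first.
  move=> _ aN0 _.
  have [k _ ak] : exists2 k, true & lnorm +oo%E a = `|a k|.
    case: m a aN0 => [|m] a aN0; first by rewrite /= big_ord0 eqxx in aN0.
    have [k _ maxE] := @eq_bigmax _ R _ 0 ord0 predT (fun j => `|a j|) isT
      (fun _ _ => normr_ge0 _).
    by exists k.
  (* For q = +oo the unit vector at a largest entry of a is extremal. *)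
  exists (fun j => (j == k)%:R); last first.
    rewrite ak; have := lnorm_coord (fun j => (j == k)%:R * a j) k p0.
    by rewrite eqxx mul1r.
  rewrite lnorm_le_sumE// powR1 (bigD1 k)//= eqxx normr1 powR1.
  rewrite big1 ?addr0// => j /negbTE ->.
  by rewrite normr0 powR0// gt_eqF.
rewrite lte_fin => y0; set N := lnorm _ a => NN0.
have N0 : 0 < N by rewrite lt_neqAle eq_sym NN0 lnorm_ge0.
pose z := (x^-1 + y^-1)^-1.
have xy0 : 0 < x^-1 + y^-1 by rewrite addr_gt0 ?invr_gt0.
have z0 : 0 < z by rewrite invr_gt0.
rewrite !inve_EFin// -EFinD -[(_ + _)%R]invrK -inve_EFin// -/z.
rewrite lee_gt0V2// => pz.
(* The r-norm of this b is that of a / N in the exponent q, namely 1; with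
   1/z = 1/r + 1/q, the z-th powers of b * a are those of the equality case
   of the Hoelder inequality, so the z-norm of b * a is exactly N. *)
exists (fun j => (`|a j| / N) `^ (y / x)).
  rewrite lnorm_le_sumE// powR1.
  under eq_bigr do rewrite ger0_norm ?powR_ge0// -powRrM divfK ?gt_eqF//.
  by rewrite lnorm_normalize.
apply: le_trans (ler_lnorm_index _ p0 pz).
rewrite lnorm_ge_sumE ?(ltW N0)//.
have zyx : (y / x + 1) * z = y.
  by rewrite /z; field; rewrite !gt_eqF ?addr_gt0.
suff -> : \sum_(j < m) `|(`|a j| / N) `^ (y / x) * a j| `^ z =
    N `^ z * \sum_(j < m) (`|a j| / N) `^ y.
  by rewrite lnorm_normalize// mulr1.
rewrite mulr_sumr; apply: eq_bigr => j _.
have aN : `|a j| = N * (`|a j| / N) by rewrite mulrC divfK.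
have c0 : 0 <= `|a j| / N by rewrite divr_ge0 ?(ltW N0).
rewrite normrM ger0_norm ?powR_ge0// [X in _ * X]aN mulrCA.
rewrite (powRM z (ltW N0) (mulr_ge0 (powR_ge0 _ _) c0)).
congr (_ * _); set c := `|a j| / N in c0 *.
rewrite -{2}(powRr1 c0) -powRD; last by rewrite gt_eqF// addr_gt0 ?divr_gt0.
by rewrite -powRrM zyx.
Qed.

End lnorm_theory.

(** * Weak and mixed Lipschitz norms *)

Section weak_theory.
Context {R : realType} {X : metricType R} (x0 : X).

Lemma lip_dual_ball_cst0 : lip_dual_ball x0 (cst 0%R : X -> R).
Proof.
have bound0 : lip_bound (cst 0%R : X -> R^o) 0%R.
  by split => // x y; rewrite mul0r /= mdistxx.
split; first by split => //; exists 0%R.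
apply: le_trans (ler01); apply: ge_inf => //.
by exists 0%R => C [].
Qed.

(** The dual ball contains 0, hence the supremum is over a nonempty set and is
    never -oo. *)
Lemma weak_lip_lnorm_ge0 p m (sigma : 'I_m -> R) (x' x'' : 'I_m -> X) :
  0 <= weak_lip_lnorm x0 p sigma x' x''.
Proof.
apply: (@le_trans _ _ (lnorm p (fun j => sigma j * (0 - 0)))%:E).
  by rewrite lee_fin lnorm_ge0.
by apply: ereal_sup_ubound; exists (cst 0%R); first exact: lip_dual_ball_cst0.
Qed.

(** The multiplier b does not depend on f, so the Hoelder inequality may be
    applied under the supremum over the dual ball. *)
Lemma weak_lip_lnorm_hoelder r s t m (b sigma : 'I_m -> R)
    (x' x'' : 'I_m -> X) :
  0 < r -> 0 < s -> 0 < t -> r^-1 + s^-1 = t^-1 -> (lnorm r b <= 1)%R ->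
  weak_lip_lnorm x0 t (fun j => (b j * sigma j)%R) x' x'' <=
    weak_lip_lnorm x0 s sigma x' x''.
Proof.
move=> r0 s0 t0 rst b1; apply: ge_ereal_sup => _ [f fB <-].
apply: le_trans (ereal_sup_ubound _); last by exists f.
rewrite lee_fin; under [X in lnorm _ X]funext do rewrite -mulrA.
apply: le_trans (lnorm_hoelder _ _ r0 s0 t0 rst) _.
by rewrite ler_piMl ?lnorm_ge0.
Qed.

(** For C > 0, dividing by C turns the hypothesis into a lower bound of the
    infimum. For C = 0 both right-hand sides vanish, and a single tau
    suffices. *)
Lemma le_mixed_lip_norm s q m (sigma : 'I_m -> R) (x' x'' : 'I_m -> X)
    (C : R) (u : \bar R) : (0 <= C)%R ->
  (forall tau : 'I_m -> R, (forall j, tau j != 0%R) ->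
    u <= C%:E * ((lnorm (conj_index s q) tau)%:E *
      weak_lip_lnorm x0 s (fun j => (sigma j / tau j)%R) x' x'')) ->
  u <= C%:E * mixed_lip_norm x0 s q sigma x' x''.
Proof.
rewrite le_eqVlt => /predU1P[<-|C0] h.
  by have := h (fun=> 1%R) (fun=> oner_neq0 R); rewrite !mul0e.
rewrite -lee_pdivrMl//; apply: le_ereal_inf_tmp => _ [tau tau0 <-].
by rewrite lee_pdivrMl//; exact: h.
Qed.

End weak_theory.

(** * Comparison of summing constants *)

(** Every constant admissible for the first triple of indices is admissible
    for the second: an extremal multiplier turns the p2-norm of the images
    into a p1-norm at the cost of an r-norm, and the Hoelder inequality pays
    that cost on the side of the weak norm. The same tau serves in both mixed
    norms, so the constant is not changed. *)
Lemma summing_bound_incl (R : realType) (X Y : metricType R) (x0 : X)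
    (p1 p2 q1 q2 s1 s2 : \bar R) (T : X -> Y) :
  0 < p1 -> p1 <= p2 -> 0 < q1 -> q1 <= q2 -> 0 < s1 -> s1 <= s2 ->
  q1 <= s1 -> q2 <= s2 ->
  q1^-1 - q2^-1 <= s1^-1 - s2^-1 -> s1^-1 - s2^-1 <= p1^-1 - p2^-1 ->
  summing_bound x0 p1 s1 q1 T `<=` summing_bound x0 p2 s2 q2 T.
Proof.
move=> p10 p12 q10 q12 s10 s12 qs1 qs2 hqs hsp C [C0 TC].
split=> // m sigma x' x''.
apply: le_mixed_lip_norm => // tau tau0.
have s20 := lt_le_trans s10 s12; have p20 := lt_le_trans p10 p12.
have q20 := lt_le_trans q10 q12.
(* 1/r = 1/s1 - 1/s2 *)
pose r := conj_index s2 s1.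
have r0 : 0 < r by exact: conj_index_gt0.
have rs : r^-1 + s2^-1 = s1^-1 by exact: conj_indexE.
have rp : r^-1 + p2^-1 <= p1^-1.
  rewrite /r /conj_index inveK -leeBrDr//.
  exact: inve_fin_num.
have [b b1 hb] := lnorm_extremal_mult
  (fun j => (sigma j * mdist (T (x' j)) (T (x'' j)))%R) p10 p20 r0 rp.
(* The inequality between 1/q1 - 1/q2 and 1/s1 - 1/s2 says exactly that
   s2'(q2) <= s1'(q1). *)
have tau_le : (lnorm (conj_index s1 q1) tau <= lnorm (conj_index s2 q2) tau)%R.
  apply: ler_lnorm_index; first exact: conj_index_gt0.
  rewrite -lee_gt0V2 ?conj_index_gt0// /conj_index !inveK.
  exact: leeB_inve_swap.
apply: (@le_trans _ _ (strong_lnorm p1 (fun j => (b j * sigma j)%R)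
                               (T \o x') (T \o x''))%:E).
  rewrite lee_fin; apply: le_trans hb _; apply: ler_lnorm => // j.
  by rewrite mulrA.
apply: le_trans (TC _ _ _ _) _; apply: lee_wpmul2l => //.
apply: le_trans (ereal_inf_lbound _) _; first by exists tau.
apply: lee_pmul => //; rewrite ?lee_fin ?lnorm_ge0 ?weak_lip_lnorm_ge0//.
under [X in weak_lip_lnorm _ _ X]funext do rewrite -mulrA.
exact: weak_lip_lnorm_hoelder r0 s20 s10 rs b1.
Qed.

Theorem proposition4p14 (R : realType) (X Y : metricType R) (x0 : X) (y0 : Y)
    (p1 p2 q1 q2 s1 s2 : \bar R)
    (p1_gt0 : 0 < p1) (p12 : p1 <= p2)
    (q1_gt0 : 0 < q1) (q12 : q1 <= q2)
    (s1_gt0 : 0 < s1) (s12 : s1 <= s2)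
    (qs1 : q1 <= s1) (qs2 : q2 <= s2)
    (qp1 : q1 <= p1) (qp2 : q2 <= p2)
    (hqs : q1^-1 - q2^-1 <= s1^-1 - s2^-1)
    (hsp : s1^-1 - s2^-1 <= p1^-1 - p2^-1) :
  @lip_mixed_summing R X Y x0 p1 s1 q1 `<=`
    @lip_mixed_summing R X Y x0 p2 s2 q2 /\
  forall T : X -> Y, lip_mixed_summing x0 p1 s1 q1 T ->
    lip_mixed_summing_norm x0 p2 s2 q2 T <=
      lip_mixed_summing_norm x0 p1 s1 q1 T.
Proof.
have incl T : summing_bound x0 p1 s1 q1 T `<=` summing_bound x0 p2 s2 q2 T
  by exact: summing_bound_incl.
split=> [T [lipT [C TC]]|T _]; first by split=> //; exists C; exact: incl.
by apply: ereal_inf_le_tmp; exact: image_subset.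
Qed.
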